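(* Let $A\in\mathbb{R}^{n\times n}$ be symmetric and definite (positive or negative), let $v\in\mathbb{R}^n$ be a unit norm vector, and let $\xi_1,\dots,\xi_m$ be nonzero real shifts with sign opposite to that of the eigenvalues of $A$. Let $q_1,q_2,\dots$ and $\alpha_j,\beta_j$ be the orthonormal vectors and coefficients generated by the short-term rational Lanczos recurrence for $A$, $v$ and these shifts, and let $Q_j=[q_1,\dots,q_j]$ (see context). Assume that the recurrence does not break down and that the matrices $K_1,\dots,K_m$ defined in the context are nonsingular. Then at the $j$th iteration, $1\le j\le m$, the last column (equivalently, the transpose of the last row) of $J_j=Q_j^TAQ_j$ is given by $$ J_je_j=\widehat y_j-\frac{\beta_j^2}{\xi_j^2}\,\frac{\xi_j-\eta}{\omega_j}\,t_j, $$ where $\eta=q_{j+1}^TAq_{j+1}$, the scalars $\omega_j$ and vectors $y_j,t_j\in\mathbb{R}^j$ are defined by the recurrences in the context, and $\widehat y_j:=H_jy_j$ satisfies $$ \widehat y_1=\alpha_1,\qquad \widehat y_j=\begin{bmatrix}-\widehat y_{j-1}\dfrac{\beta_{j-1}}{\xi_{j-2}\,\omega_j}\\[2mm] \beta_{j-1}e_{j-1}^Ty_j+\dfrac{\alpha_j}{\omega_j}\end{bmatrix}+\frac{\beta_{j-1}}{\omega_j}e_{j-1}\quad\text{for } j>1 . $$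
   Context: Conventions: $\xi_{-1}=\xi_0=\infty$, $1/\infty=0$, $\beta_0=0$, $q_0=0$, $q_1=v$; $e_i$ is the $i$th column of the identity matrix whose size is clear from the context. Rational Lanczos recurrence: for $j=1,\dots,m$ set $r=(I-\xi_j^{-1}A)^{-1}\bigl(Aq_j-\beta_{j-1}(I-\xi_{j-2}^{-1}A)q_{j-1}\bigr)$, $s=(I-\xi_j^{-1}A)^{-1}(I-\xi_{j-1}^{-1}A)q_j$, $\alpha_j=(r^Tq_j)/(s^Tq_j)$, $\beta_j=\|r-\alpha_j s\|$ (Euclidean norm), $q_{j+1}=(r-\alpha_j s)/\beta_j$. No breakdown means $\beta_j\neq 0$ for all $j$ considered. Thus $\beta_j(I-\xi_j^{-1}A)q_{j+1}=Aq_j-\alpha_j(I-\xi_{j-1}^{-1}A)q_j-\beta_{j-1}(I-\xi_{j-2}^{-1}A)q_{j-1}$. It is a known fact that in exact arithmetic the vectors $q_1,q_2,\dots,q_{m+1}$ are orthonormal and that $q_1,\dots,q_j$ span the rational Krylov subspace $\mathrm{span}\{v,(I-\xi_1^{-1}A)^{-1}v,\dots,\prod_{i=1}^{j-1}(I-\xi_i^{-1}A)^{-1}v\}$. $H_j\in\mathbb{R}^{j\times j}$ is the symmetric tridiagonal matrix with diagonal $\alpha_1,\dots,\alpha_j$ and off-diagonal entries $\beta_1,\dots,\beta_{j-1}$. $K_j\in\mathbb{R}^{j\times j}$ is the tridiagonal matrix with diagonal entries $(K_j)_{i,i}=1+\alpha_i/\xi_{i-1}$, superdiagonal entries $(K_j)_{i-1,i}=\beta_{i-1}/\xi_{i-2}$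 and subdiagonal entries $(K_j)_{i,i-1}=\beta_{i-1}/\xi_{i-1}$. The quantities $\omega_j,y_j,t_j$ are: $\omega_1=1$, $\omega_2=\alpha_2/\xi_1+1$, $\omega_j=\alpha_j/\xi_{j-1}+1-\beta_{j-1}^2/(\xi_{j-1}\xi_{j-2}\omega_{j-1})$ for $j\ge3$; $y_1=t_1=1$ and, for $j\ge2$, $y_j=\frac1{\omega_j}\left(e_j-\frac{\beta_{j-1}}{\xi_{j-2}}\begin{bmatrix}y_{j-1}\\0\end{bmatrix}\right)$, $t_j=\frac1{\omega_j}\left(e_j-\frac{\beta_{j-1}}{\xi_{j-1}}\begin{bmatrix}t_{j-1}\\0\end{bmatrix}\right)$. (They satisfy $K_jy_j=e_j$ and $K_j^Tt_j=e_j$.) *)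

(* Defs.v *)
From mathcomp Require Import all_boot all_order all_algebra.

Set Implicit Arguments.
Unset Strict Implicit.
Unset Printing Implicit Defensive.

Import Order.TTheory GRing.Theory Num.Theory.
Local Open Scope ring_scope.

(* All sequences (xi, alpha, beta, q, omega, y, t) and all vector and matrix
   entries carry 1-based indices; an ordinal i : 'I_k stands for i.+1. *)

Definition dotv (R : rcfType) n (u w : 'cV[R]_n) : R := (u^T *m w) 0 0.

Definition enorm (R : rcfType) n (u : 'cV[R]_n) : R := Num.sqrt (dotv u u).

Definition definite (R : rcfType) n (A : 'M[R]_n) : Prop :=
  (forall x : 'cV[R]_n, x != 0 -> 0 < dotv x (A *m x)) \/
  (forall x : 'cV[R]_n, x != 0 -> dotv x (A *m x) < 0).

(* 1 / xi_j with xi_0 = xi_{-1} = oo and 1 / oo = 0. Indices are naturals with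
   truncated subtraction, so for j = 1 the index j - 2 is 0 instead of -1,
   which gives the same value 0. The value [xi 0] is never used. *)
Definition shiftV (R : rcfType) (xi : nat -> R) (j : nat) : R :=
  if j is 0 then 0 else (xi j)^-1.

(* I - xi_j^{-1} A *)
Definition shiftmx (R : rcfType) n (A : 'M[R]_n) (xi : nat -> R) (j : nat) :
    'M[R]_n :=
  1%:M - shiftV xi j *: A.

Definition rational_lanczos (R : rcfType) n (A : 'M[R]_n) (v : 'cV[R]_n)
    (m : nat) (xi : nat -> R)
    (q : nat -> 'cV[R]_n) (alpha beta : nat -> R) : Prop :=
  [/\ q 0%N = 0, q 1%N = v, beta 0%N = 0 &
    forall j : nat, (1 <= j <= m)%N ->
      let r := invmx (shiftmx A xi j) *m
        (A *m q j - beta (j - 1)%N *: (shiftmx A xi (j - 2) *m q (j - 1)%N)) in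
      let s := invmx (shiftmx A xi j) *m (shiftmx A xi (j - 1) *m q j) in
      [/\ alpha j = dotv r (q j) / dotv s (q j),
          beta j = enorm (r - alpha j *: s) &
          q j.+1 = (beta j)^-1 *: (r - alpha j *: s)]].

(* e_i in R^k *)
Definition evec (R : rcfType) k (i : nat) : 'cV[R]_k :=
  \col_(l < k) (l.+1 == i)%:R.
Arguments evec {R} k i.

(* the column vector [u; a] *)
Definition snoc (R : rcfType) k (u : 'cV[R]_k) (a : R) : 'cV[R]_k.+1 :=
  \col_(l < k.+1) (if unlift ord_max l is Some l' then u l' 0 else a).

Definition Qmx (R : rcfType) n (q : nat -> 'cV[R]_n) (j : nat) : 'M[R]_(n, j) :=
  \matrix_(i < n, l < j) q l.+1 i 0.

Definition Jmx (R : rcfType) n (A : 'M[R]_n) (q : nat -> 'cV[R]_n) (j : nat) :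
    'M[R]_j :=
  (Qmx q j)^T *m A *m Qmx q j.

Definition Hmx (R : rcfType) (alpha beta : nat -> R) (j : nat) : 'M[R]_j :=
  \matrix_(i < j, l < j)
    if i == l :> nat then alpha i.+1
    else if i.+1 == l then beta i.+1
    else if i == l.+1 :> nat then beta l.+1
    else 0.

Definition Kmx (R : rcfType) (xi alpha beta : nat -> R) (j : nat) : 'M[R]_j :=
  \matrix_(i < j, l < j)
    let i1 := i.+1 in
    let l1 := l.+1 in
    if i1 == l1 then 1 + alpha i1 * shiftV xi (i1 - 1)
    else if i1.+1 == l1 then beta (l1 - 1)%N * shiftV xi (l1 - 2)
    else if i1 == l1.+1 then beta (i1 - 1)%N * shiftV xi (i1 - 1)
    else 0.

Fixpoint omega (R : rcfType) (xi alpha beta : nat -> R) (j : nat) : R :=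
  match j with
  | 0 | 1 => 1
  | 2 => alpha 2%N / xi 1%N + 1
  | j'.+1 => alpha j / xi (j - 1)%N + 1
      - beta (j - 1)%N ^+ 2
        / (xi (j - 1)%N * xi (j - 2)%N * omega xi alpha beta j')
  end.

(* The vectors of R^j with z_1 = 1 and, for j >= 2,
   z_j = (e_j - c_j [z_{j-1}; 0]) / w_j. *)
Fixpoint zvec (R : rcfType) (w c : nat -> R) (j : nat) : 'cV[R]_j :=
  match j return 'cV[R]_j with
  | 0 => 0
  | p.+1 =>
      (if p is 0 then fun=> const_mx 1
       else fun z => (w p.+1)^-1 *: (evec p.+1 p.+1 - c p.+1 *: snoc z 0))
      (zvec w c p)
  end.

Definition yvec (R : rcfType) (xi alpha beta : nat -> R) : forall j, 'cV[R]_j :=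
  zvec (omega xi alpha beta) (fun j => beta (j - 1)%N * shiftV xi (j - 2)).

Definition tvec (R : rcfType) (xi alpha beta : nat -> R) : forall j, 'cV[R]_j :=
  zvec (omega xi alpha beta) (fun j => beta (j - 1)%N * shiftV xi (j - 1)).

Definition yhat (R : rcfType) (xi alpha beta : nat -> R) (j : nat) : 'cV[R]_j :=
  Hmx alpha beta j *m yvec xi alpha beta j.

(* Main.v *)
Require Import Defs.
From mathcomp Require Import all_boot all_order all_algebra.
From mathcomp Require Import complex.
From mathcomp Require Import ring lra zify.
Import Order.TTheory GRing.Theory Num.Theory.
Local Open Scope ring_scope.

Set Implicit Arguments.
Unset Strict Implicit.
Unset Printing Implicit Defensive.

(** Write s_j = 1/xi_j, B_j = I - s_j A and e for the last unit vector. The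
    recurrence, read column by column, is the matrix identity
      A (Q_j K_j + beta_j s_j q_{j+1} e^T) = Q_j H_j + beta_j q_{j+1} e^T
    ([lanczos_matrix]). Suppose q_1, ..., q_{j+1} are orthonormal and put
    g = Q_j^T A q_{j+1}. Multiplying by q_{j+1}^T gives
    K_j^T g = beta_j (1 - s_j eta) e, so g = beta_j (1 - s_j eta) t_j.
    Multiplying by Q_j^T gives J_j K_j + beta_j s_j g e^T = H_j, and applying
    both sides to y_j, whose last entry is 1/omega_j, gives the formula for
    J_j e ([Jmx_last_col]). The facts about y_j, t_j and omega_j are one step of
    Gaussian elimination on a tridiagonal matrix ([tridiag_pivot]): the omega_j
    are its pivots. The recursion for H_j y_j is the same block computation.

    The substantial part is that a three-term recurrence makes all the q_j
    orthonormal ([lanczos_orthonormalP]). Let w = beta_{k+1} q_{k+2}, and let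
    X and Y = A X be the two n x k matrices of the identity above for k.
    Orthonormality up to index k+1 alone gives X^T B_{k+1} w = 0: the
    coefficients of the three terms of the recurrence cancel. Now B_{k+1} X has
    columns in span(q_1, ..., q_{k+1}), and w is orthogonal to q_{k+1} by the
    choice of alpha_{k+1}; hence P^T (Q_k^T w) = 0 with
    P = K_k - s_{k+1} H_k, and it remains to see that P is nonsingular, which is
    where the sign condition on the shifts enters ([lanczos_step_orth]).

    The sign condition speaks of the eigenvalues of A, so it has content only
    because a symmetric matrix over a real closed field has an eigenvalue
    ([symmetric_eigenvalue]). It makes every B_j positive definite, and
    x^T B_i B_j^{-1} x positive for x nonzero ([pencil_ratio_gt0]); with x = q_j
    and i = j - 1 this is the denominator of alpha_j. *)

(** * The Euclidean inner product *)

Section InnerProduct.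
Context {R : rcfType} {n : nat}.
Implicit Types (u w x : 'cV[R]_n) (M : 'M[R]_n) (a : R).

Lemma dotvE u w : dotv u w = \sum_i u i 0 * w i 0.
Proof. by rewrite /dotv mxE; apply: eq_bigr => i _; rewrite mxE. Qed.

Lemma dotvC u w : dotv u w = dotv w u.
Proof. by rewrite !dotvE; apply: eq_bigr => i _; rewrite mulrC. Qed.

Lemma dotvBr u w x : dotv u (w - x) = dotv u w - dotv u x.
Proof. by rewrite /dotv mulmxBr !mxE. Qed.

Lemma dotvZr a u w : dotv u (a *: w) = a * dotv u w.
Proof. by rewrite /dotv -scalemxAr mxE. Qed.

Lemma dotv0 u : dotv u 0 = 0.
Proof. by rewrite /dotv mulmx0 mxE. Qed.

Lemma dotvM u M w : dotv u (M *m w) = dotv (M^T *m u) w.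
Proof. by rewrite /dotv trmx_mul trmxK mulmxA. Qed.

Lemma dotvv_ge0 u : 0 <= dotv u u.
Proof. by rewrite dotvE sumr_ge0 // => i _; rewrite -expr2 sqr_ge0. Qed.

Lemma dotvv_eq0 u : (dotv u u == 0) = (u == 0).
Proof.
apply/eqP/eqP => [|->]; last exact: dotv0.
rewrite dotvE => /eqP.
rewrite psumr_eq0; last by move=> i _; rewrite -expr2 sqr_ge0.
move=> /allP u0; apply/colP => i; rewrite mxE; apply/eqP.
by have := u0 i (mem_index_enum i); rewrite /= mulf_eq0 orbb.
Qed.

Lemma dotvv_gt0 u : u != 0 -> 0 < dotv u u.
Proof. by rewrite lt_def dotvv_ge0 andbT dotvv_eq0. Qed.

Lemma trmx_mul_dotv u w : u^T *m w = (dotv u w)%:M.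
Proof. by rewrite [LHS]mx11_scalar. Qed.

End InnerProduct.

(** * Real eigenvalues of symmetric matrices *)

Lemma unitmx_ker0 (F : fieldType) k (P : 'M[F]_k) :
  (forall c : 'cV_k, P *m c = 0 -> c = 0) -> P \in unitmx.
Proof.
move=> P0; rewrite -unitmx_tr -row_free_unit -kermx_eq0; apply/eqP/row_matrixP => i.
rewrite row0; apply: trmx_inj; rewrite trmx0; apply: P0.
by rewrite -{1}[P]trmxK -trmx_mul -row_mul mulmx_ker row0 trmx0.
Qed.

(** Over R[i] the matrix is Hermitian, so it is unitarily diagonalisable with
    real diagonal. A real eigenvalue over R[i] is a root of a characteristic
    polynomial with coefficients in R, hence an eigenvalue over R. *)
Lemma symmetric_eigenvalue (R : rcfType) n (A : 'M[R]_n) :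
  (0 < n)%N -> A^T = A -> exists a, eigenvalue A a.
Proof.
move=> n_gt0 A_sym; pose C := R[i]; pose AC : 'M[C]_n := map_mx (real_complex R) A.
have AC_herm : AC \is hermsymmx.
  apply: realsym_hermsym.
    apply/is_hermitianmxP; rewrite expr0 scale1r; apply/matrixP => i j.
    by rewrite !mxE -[in LHS]A_sym mxE.
  by apply/mxOverP => i j; rewrite mxE; apply/complex_realP; exists (A i j).
have /mxOverP d_real := hermitian_spectral_diag_real AC_herm.
have /hermitian_normalmx/orthomx_spectralP AC_E := AC_herm.
set P := spectralmx AC in AC_E; set d := spectral_diag AC in AC_E d_real.
pose i := Ordinal n_gt0.
have /complex_realP [a da] := d_real 0 i.
exists a; rewrite eigenvalue_root_char -(fmorph_root (real_complex R)).
rewrite map_char_poly -/AC -eigenvalue_root_char; apply/eigenvalueP.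
have Pu : P \in unitmx by exact: spectral_unit.
exists (row i P).
  have := congr1 (mulmx (row i P)) AC_E.
  rewrite !mulmxA -[in X in _ = X -> _]row_mul mulmxV // row1 -rowE row_diag_mx.
  by rewrite -scalemxAl -rowE da.
apply/eqP => Pi0.
have: row i P *m invmx P = 0 by rewrite Pi0 mul0mx.
rewrite -row_mul mulmxV // row1 => /rowP/(_ i); rewrite !mxE eqxx.
by move/eqP; rewrite oner_eq0.
Qed.

(** * The matrices I - s A *)

Definition pencil (R : rcfType) n (A : 'M[R]_n) (s : R) : 'M[R]_n := 1%:M - s *: A.

Section Pencil.
Context {R : rcfType} {n : nat} {A : 'M[R]_n} (A_sym : A^T = A).
Implicit Types (s : R) (x q : 'cV[R]_n).

Lemma pencil_mul s x : pencil A s *m x = x - s *: (A *m x).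
Proof. by rewrite mulmxBl mul1mx -scalemxAl. Qed.

Lemma tr_pencil s : (pencil A s)^T = pencil A s.
Proof. by rewrite /pencil linearB linearZ /= trmx1 A_sym. Qed.

(** A kernel vector x satisfies x = s A x, so that x^T x = s x^T A x <= 0. *)
Lemma pencil_unit s : (forall x, s * dotv x (A *m x) <= 0) -> pencil A s \in unitmx.
Proof.
move=> s_le0; apply: unitmx_ker0 => x; rewrite pencil_mul => /eqP.
rewrite subr_eq0 => /eqP xE; apply/eqP; rewrite -dotvv_eq0.
by rewrite eq_le dotvv_ge0 andbT {2}xE dotvZr s_le0.
Qed.

(** With z = (I - s A)^-1 q the product equals ((I - s A) z)^T (I - s' A) z, which
    is |z|^2 - (s + s') z^T A z + s s' |A z|^2: the first term is positive, the
    others are nonnegative. *)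
Lemma pencil_ratio_gt0 s s' q : q != 0 ->
  (forall x, s * dotv x (A *m x) <= 0) -> (forall x, s' * dotv x (A *m x) <= 0) ->
  0 <= s * s' -> 0 < dotv q (pencil A s' *m (invmx (pencil A s) *m q)).
Proof.
move=> q0 s_le0 s'_le0 ss'_ge0; have Bu := pencil_unit s_le0.
set z := _ *m q; have qE : q = pencil A s *m z by rewrite mulKVmx.
have z0 : z != 0 by apply: contraNneq q0 => z0; rewrite qE z0 mulmx0.
rewrite qE !pencil_mul !(dotvBr, dotvZr) 2!(dotvC (_ - _)) !(dotvBr, dotvZr).
rewrite (dotvC (A *m z) z).
have := dotvv_gt0 z0; have := dotvv_ge0 (A *m z); have := s_le0 z; have := s'_le0 z.
move=> h1 h2 h3 h4; have := mulr_ge0 ss'_ge0 h3; nra.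
Qed.
End Pencil.

(** * Orthogonality from a short recurrence *)

(** Here Q, q and w stand for Q_k, q_{k+1} and beta_{k+1} q_{k+2}; the scalars
    s, s', s'' are the inverse shifts of index k+1, k, k-1, while a = alpha_{k+1},
    b = beta_k, and e is the k-th unit vector, so that Q e = q_k.

    With A X = Y the hypothesis that relates K and H, q is orthogonal to
    the columns of (I - s' A) X, since its products with X and Y are b s' e and
    b e. The same bookkeeping, with the hypothesis on K^T e - s'' H^T e, gives
    X^T (I - s A) w = 0, i.e. (K - s H)^T Q^T w = 0 once w is orthogonal to q.
    If (K - s H) c = 0 then (I - s A) X c = d q for some scalar d, and pairing
    (I - s' A) X c with q gives d q^T (I - s' A) (I - s A)^-1 q = 0; so d = 0,
    X c = 0, and finally K c = Q^T X c = 0. *)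
Lemma lanczos_step_orth (R : rcfType) n (A : 'M[R]_n) k (Q : 'M[R]_(n, k))
    (K H : 'M[R]_k) (e : 'cV[R]_k) (q w : 'cV[R]_n) (a b s s' s'' : R) :
  A^T = A -> Q^T *m Q = 1%:M -> Q^T *m q = 0 -> dotv q q = 1 ->
  A *m (Q *m K + (b * s') *: (q *m e^T)) = Q *m H + b *: (q *m e^T) ->
  K^T *m e - s'' *: (H^T *m e) = e ->
  K \in unitmx -> pencil A s \in unitmx ->
  dotv q (pencil A s' *m (invmx (pencil A s) *m q)) != 0 ->
  pencil A s *m w = A *m q - a *: (pencil A s' *m q)
                    - b *: (pencil A s'' *m (Q *m e)) ->
  dotv q w = 0 -> Q^T *m w = 0.
Proof.
move=> A_sym QQ Qq qq AX KHe Ku Bu ratio0 Bw qw.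
set X := (X in A *m X = _) in AX; set Y := (Y in _ = Y) in AX.
have qQ : q^T *m Q = 0 by apply: trmx_inj; rewrite trmx_mul trmxK Qq trmx0.
have qqT : q^T *m q = 1%:M by rewrite trmx_mul_dotv qq.
have trX : X^T = K^T *m Q^T + (b * s') *: (e *m q^T).
  by rewrite /X linearD linearZ /= !trmx_mul trmxK.
have trY : Y^T = H^T *m Q^T + b *: (e *m q^T).
  by rewrite /Y linearD linearZ /= !trmx_mul trmxK.
have Xq : X^T *m q = (b * s') *: e.
  by rewrite trX mulmxDl -scalemxAl -!mulmxA Qq qqT mulmx0 add0r mulmx1.
have Yq : Y^T *m q = b *: e.
  by rewrite trY mulmxDl -scalemxAl -!mulmxA Qq qqT mulmx0 add0r mulmx1.
have XQ : X^T *m Q = K^T.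
  by rewrite trX mulmxDl -scalemxAl -!mulmxA QQ qQ !mulmx0 scaler0 addr0 mulmx1.
have YQ : Y^T *m Q = H^T.
  by rewrite trY mulmxDl -scalemxAl -!mulmxA QQ qQ !mulmx0 scaler0 addr0 mulmx1.
have XA x : X^T *m (A *m x) = Y^T *m x by rewrite mulmxA -{1}A_sym -trmx_mul AX.
have XB z (x : 'cV_n) : X^T *m (pencil A z *m x) = X^T *m x - z *: (Y^T *m x).
  by rewrite pencil_mul mulmxBr -scalemxAr XA.
have XB'q : X^T *m (pencil A s' *m q) = 0.
  by rewrite XB Xq Yq scalerA mulrC subrr.
have XBw : X^T *m (pencil A s *m w) = 0.
  rewrite Bw !mulmxBr -!scalemxAr XB'q XA Yq XB !mulmxA XQ YQ KHe.
  by rewrite scaler0 subr0 subrr.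
pose P := K - s *: H.
have BX : pencil A s *m X = Q *m P + (b * (s' - s)) *: (q *m e^T).
  rewrite mulmxBl mul1mx -scalemxAl AX /X /Y /P mulmxBr -scalemxAr scalerDr scalerA.
  by rewrite mulrBr scalerBl opprD addrACA [s * b]mulrC.
have Pu : P \in unitmx.
  apply: unitmx_ker0 => c Pc.
  have [d Xc] : exists d, X *m c = d *: (invmx (pencil A s) *m q).
    exists (b * (s' - s) * dotv e c).
    rewrite -[LHS](mulKmx Bu) (mulmxA _ X) BX mulmxDl -mulmxA Pc mulmx0 add0r.
    rewrite -scalemxAl -mulmxA trmx_mul_dotv mul_mx_scalar scalerA.
    by rewrite -scalemxAr.
  have d0 : d = 0.
    have : dotv q (pencil A s' *m (X *m c)) = 0.
      rewrite dotvM (tr_pencil A_sym) /dotv trmx_mul.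
      have : (X^T *m (pencil A s' *m q))^T *m c = 0 by rewrite XB'q trmx0 mul0mx.
      rewrite !trmx_mul trmxK !mulmxA => ->; by rewrite mxE.
    rewrite Xc -scalemxAr dotvZr => /eqP.
    by rewrite mulf_eq0 (negPf ratio0) orbF => /eqP.
  have QX : Q^T *m X = K by apply: trmx_inj; rewrite trmx_mul trmxK XQ.
  by rewrite -[LHS](mulKmx Ku) -QX -mulmxA Xc d0 scale0r !mulmx0.
have PQw : P^T *m (Q^T *m w) = 0.
  have trBX : X^T *m (pencil A s *m w) = (pencil A s *m X)^T *m w.
    by rewrite trmx_mul (tr_pencil A_sym) mulmxA.
  move: XBw; rewrite trBX BX linearD linearZ /= !trmx_mul trmxK.
  rewrite mulmxDl -scalemxAl -[e *m _ *m w]mulmxA trmx_mul_dotv qw mul_mx_scalar.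
  by rewrite scale0r scaler0 addr0 mulmxA.
by rewrite -[LHS](mulKmx (_ : P^T \in unitmx)) ?unitmx_tr // PQw mulmx0.
Qed.

(** * Tridiagonal matrices *)

Section Tridiagonal.
Context {R : rcfType}.
Implicit Types (d u s w c : nat -> R).

(** In 1-based indices the entries (i, i), (i, i+1) and (i+1, i) are [d i],
    [u i] and [s i]. *)
Definition tridiag d u s k : 'M[R]_k :=
  \matrix_(i < k, l < k)
    if i == l :> nat then d i.+1
    else if i.+1 == l then u i.+1
    else if i == l.+1 :> nat then s l.+1
    else 0.

Lemma tr_tridiag d u s k : (tridiag d u s k)^T = tridiag d s u k.
Proof.
apply/matrixP => i l; rewrite !mxE [l == i :> nat]eq_sym.
case: eqVneq => [->//|_]; rewrite [l == i.+1 :> nat]eq_sym [i == l.+1 :> nat]eq_sym.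
by case: eqP => [<-|_]; case: eqP => [/eqP|_] //; rewrite gtn_eqF.
Qed.

Lemma mul_evec m k (M : 'M[R]_(m, k)) (l : 'I_k) : M *m evec k l.+1 = col l M.
Proof.
apply/colP => i; rewrite !mxE (bigD1 l) //= mxE eqxx mulr1 big1 ?addr0 // => j jl.
by rewrite mxE eqSS (inj_eq val_inj) (negPf jl) mulr0.
Qed.

(** Out-of-range unit vectors vanish; this is what lets the first and the last
    column of a tridiagonal matrix obey the formula of the inner ones. *)
Lemma evec_eq0 k l : (l == 0)%N || (k < l)%N -> evec k l = 0 :> 'cV[R]_k.
Proof.
move=> hl; apply/colP => i; rewrite !mxE; case: eqP => // il.
by have := ltn_ord i; lia.
Qed.

Lemma evec_mulmx_inj m k (M N : 'M[R]_(m, k)) :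
  (forall l, (0 < l <= k)%N -> M *m evec k l = N *m evec k l) -> M = N.
Proof.
move=> MN; apply/matrixP => i l; have := MN l.+1 (ltn_ord l).
by rewrite !mul_evec => /colP/(_ i); rewrite !mxE.
Qed.

Lemma dotv_evecl k l (x : 'cV[R]_k) (i : 'I_k) : l = i.+1 -> dotv (evec k l) x = x i 0.
Proof. by move=> ->; rewrite dotvC /dotv mul_evec !mxE. Qed.

Lemma dotv_evec k l : (0 < l <= k)%N -> dotv (evec k k) (evec k l) = (k == l)%:R :> R.
Proof.
case: k => [|k]; first by case: l.
by move=> _; rewrite (@dotv_evecl _ _ _ ord_max) // mxE.
Qed.

Lemma tridiag_evec d u s k l : (0 < l <= k)%N ->
  tridiag d u s k *m evec k l =
  u (l - 1)%N *: evec k (l - 1)%N + d l *: evec k l + s l *: evec k l.+1.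
Proof.
case: l => // l /= lk; rewrite -[l]/(nat_of_ord (Ordinal lk)) mul_evec /= subn1 /=.
apply/colP => i; rewrite !mxE /= !eqSS.
have [->|il] := eqVneq (i : nat) l.
  by rewrite (gtn_eqF (ltnSn l)) (ltn_eqF (ltnSn l)) !(mulr0, mulr1, addr0, add0r).
have [<-|_] := eqVneq i.+1 l.
  by rewrite (ltn_eqF (leqW (ltnSn i))) !(mulr0, mulr1, addr0, add0r).
by case: eqP => _; rewrite ?(mulr0, mulr1, addr0, add0r).
Qed.

Lemma Qmx_evec n (q : nat -> 'cV[R]_n) k l : (0 < l <= k)%N -> Qmx q k *m evec k l = q l.
Proof.
case: l => // l lk; rewrite -[l]/(nat_of_ord (Ordinal lk)) mul_evec.
by apply/colP => i; rewrite !mxE.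
Qed.

(** The rank-one term supplies the subdiagonal entry that lies just below the
    last row, so no column is exceptional. *)
Lemma Qmx_tridiag_evec n (q : nat -> 'cV[R]_n) d u s k l : q 0%N = 0 -> (0 < l <= k)%N ->
  (Qmx q k *m tridiag d u s k + s k *: (q k.+1 *m (evec k k)^T)) *m evec k l =
  u (l - 1)%N *: q (l - 1)%N + d l *: q l + s l *: q l.+1.
Proof.
move=> q0 lk; rewrite mulmxDl -mulmxA tridiag_evec // !mulmxDr -!scalemxAr.
rewrite -scalemxAl -mulmxA trmx_mul_dotv dotv_evec // mul_mx_scalar (Qmx_evec _ lk).
rewrite -addrA; congr (_ *: _ + _ + _).
  have [l1|l1] := posnP (l - 1)%N; last by rewrite Qmx_evec // l1 /=; lia.
  by rewrite l1 evec_eq0 ?eqxx // mulmx0 q0.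
have [<-|kl] := eqVneq k l.
  by rewrite evec_eq0 ?ltnSn ?orbT // mulmx0 scaler0 add0r scale1r.
by rewrite Qmx_evec ?scale0r ?scaler0 ?addr0 //; lia.
Qed.

Lemma snoc_lift k (x : 'cV[R]_k) a i : snoc x a (lift ord_max i) 0 = x i 0.
Proof. by rewrite mxE liftK. Qed.

Lemma snoc_max k (x : 'cV[R]_k) a : snoc x a ord_max 0 = a.
Proof. by rewrite mxE unlift_none. Qed.

Lemma colP_lift k (x y : 'cV[R]_k.+1) :
  (forall i, x (lift ord_max i) 0 = y (lift ord_max i) 0) ->
  x ord_max 0 = y ord_max 0 -> x = y.
Proof. by move=> xy_lift xy_max; apply/colP => i; case: (unliftP ord_max i) => [j|] ->. Qed.

Lemma evec_snoc k a : a *: evec k.+1 k.+1 = snoc 0 a :> 'cV[R]_k.+1.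
Proof.
apply: colP_lift => [i|]; rewrite ?snoc_lift ?snoc_max !mxE.
  by rewrite lift_max eqSS ltn_eqF ?mulr0.
by rewrite eqxx mulr1.
Qed.

Lemma snocD k (x y : 'cV[R]_k) a b : snoc x a + snoc y b = snoc (x + y) (a + b).
Proof. by apply: colP_lift => [i|]; rewrite mxE ?snoc_lift ?snoc_max ?mxE. Qed.

Lemma snocZ k (x : 'cV[R]_k) a b : b *: snoc x a = snoc (b *: x) (b * a).
Proof. by apply: colP_lift => [i|]; rewrite mxE ?snoc_lift ?snoc_max ?mxE. Qed.

Lemma snoc_evec k l : (l <= k)%N -> evec k.+1 l = snoc (evec k l) 0 :> 'cV[R]_k.+1.
Proof.
move=> lk; apply: colP_lift => [i|]; rewrite ?snoc_lift ?snoc_max !mxE.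
  by rewrite lift_max.
by rewrite gtn_eqF.
Qed.

Lemma tridiag_snoc d u s k (x : 'cV[R]_k) a :
  tridiag d u s k.+1 *m snoc x a =
  snoc (tridiag d u s k *m x + (u k * a) *: evec k k)
       (s k * dotv (evec k k) x + d k.+1 * a).
Proof.
have lw (i : 'I_k) : widen_ord (leqnSn k) i = lift ord_max i.
  by apply: ord_inj; rewrite lift_max.
apply: colP_lift => [i|]; rewrite ?snoc_lift ?snoc_max [LHS]mxE big_ord_recr /= snoc_max.
  rewrite [RHS]mxE; congr (_ + _).
    rewrite [RHS]mxE; apply: eq_bigr => l _.
    by rewrite lw snoc_lift !mxE !lift_max.
  rewrite !mxE !lift_max /= (ltn_eqF (ltn_ord i)) (ltn_eqF (leqW (ltn_ord i))).
  by case: eqP => [->|_]; rewrite ?mul0r ?mulr0 ?mulr1.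
rewrite mxE /= eqxx; congr (_ + _).
case: k x lw => [|k] x lw; first by rewrite big_ord0 dotvE big_ord0 mulr0.
rewrite (@dotv_evecl _ _ _ ord_max) // big_ord_recr big1 /= => [|l _].
  rewrite add0r lw snoc_lift mxE lift_max /=.
  by rewrite (gtn_eqF (ltnSn k)) (gtn_eqF (leqW (ltnSn k))) eqxx.
rewrite lw snoc_lift mxE lift_max /=.
have := ltn_ord l => lk.
by do 3 (case: eqP; first lia; move=> _); rewrite mul0r.
Qed.

End Tridiagonal.

(** * Pivots of a tridiagonal matrix *)

Lemma zvecS (R : rcfType) (w c : nat -> R) j :
  zvec w c j.+2 = (w j.+2)^-1 *: snoc (- c j.+2 *: zvec w c j.+1) 1.
Proof.
rewrite [LHS]/= -/(zvec w c j.+1) -[evec _ _]scale1r evec_snoc.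
by rewrite -scaleNr snocZ snocD add0r mulr0 addr0.
Qed.

(** The vector [-u_j z_j; 1] is mapped to w_{j+1} e_{j+1}: the first j rows cancel
    because T_j z_j = e_j, and the last row is the recursion for w. A zero pivot
    would thus put a vector with last entry 1 in the kernel. *)
Lemma tridiag_pivot (R : rcfType) (d u s w c : nat -> R) m :
  d 1%N = 1 -> w 1%N = 1 ->
  (forall j, (0 < j)%N -> w j.+1 = d j.+1 - u j * s j / w j) ->
  (forall j, (0 < j)%N -> c j.+1 = u j) ->
  (forall j, (0 < j <= m)%N -> tridiag d u s j \in unitmx) ->
  forall j, (0 < j <= m)%N ->
  [/\ w j != 0, tridiag d u s j *m zvec w c j = evec j j &
      dotv (evec j j) (zvec w c j) = (w j)^-1].
Proof.
move=> d1 w1 wS cS Tu; elim=> // -[|j] IH jm.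
  split; first by rewrite w1 oner_eq0.
    by apply/colP => i; rewrite !ord1 !mxE big_ord1 !mxE /= d1 mulr1.
  by rewrite (@dotv_evecl _ 1 1 (zvec w c 1) ord0) // mxE w1 invr1.
have {IH} [w0 Tz ez] := IH (ltnW jm).
have zE : zvec w c j.+2 = (w j.+2)^-1 *: snoc (- u j.+1 *: zvec w c j.+1) 1.
  by rewrite zvecS cS.
have Tsnoc : tridiag d u s j.+2 *m snoc (- u j.+1 *: zvec w c j.+1) 1 =
             w j.+2 *: evec j.+2 j.+2.
  rewrite tridiag_snoc -scalemxAr Tz dotvZr ez scaleNr mulr1 addNr evec_snoc.
  congr snoc; rewrite [in RHS]wS //; ring.
have w'0 : w j.+2 != 0.
  apply/eqP => w'0; move: Tsnoc; rewrite w'0 scale0r => Tsnoc.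
  have := mulKmx (Tu _ jm) (snoc (- u j.+1 *: zvec w c j.+1) 1).
  rewrite Tsnoc mulmx0 => /colP/(_ ord_max); rewrite snoc_max mxE => /eqP.
  by rewrite eq_sym oner_eq0.
split=> //; first by rewrite zE -scalemxAr Tsnoc scalerA mulVf // scale1r.
by rewrite (@dotv_evecl _ _ _ _ ord_max) // zE mxE snoc_max mulr1.
Qed.

(** * The rational Lanczos recurrence *)

Section Lanczos.
Context (R : rcfType) (n m : nat) (A : 'M[R]_n) (v : 'cV[R]_n).
Context (xi : nat -> R) (q : nat -> 'cV[R]_n) (alpha beta : nat -> R).

Local Notation sV := (shiftV xi).

Lemma Hmx_tridiag j : Hmx alpha beta j = tridiag alpha beta beta j.
Proof. by []. Qed.

Lemma Kmx_tridiag j : Kmx xi alpha beta j =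
  tridiag (fun i => 1 + alpha i * sV (i - 1)) (fun i => beta i * sV (i - 1))
          (fun i => beta i * sV i) j.
Proof.
apply/matrixP => i l; rewrite !mxE /= !eqSS.
case: eqP => // _; case: eqP => [<-|_]; first by rewrite !subSS subn0.
by case: eqP => // ->; rewrite subSS subn0.
Qed.

(** With 1 / xi_0 = 0 the three defining cases of omega become one. *)
Lemma omegaS j : (0 < j)%N ->
  omega xi alpha beta j.+1 = (1 + alpha j.+1 * sV (j.+1 - 1))
    - (beta j * sV (j - 1)) * (beta j * sV j) / omega xi alpha beta j.
Proof.
case: j => // -[|j] _; first by rewrite /= mulr0 !mul0r subr0 addrC.
have -> : omega xi alpha beta j.+3 =
    alpha j.+3 / xi j.+2 + 1
    - beta j.+2 ^+ 2 / (xi j.+2 * xi j.+1 * omega xi alpha beta j.+2).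
  by [].
rewrite subSS subn0 [sV _]/= subn1 /= !invfM; ring.
Qed.

Hypotheses (A_sym : A^T = A) (A_def : definite A) (v_unit : enorm v = 1).
Hypothesis (xi_sign : forall (j : nat) (a : R), (1 <= j <= m)%N ->
       eigenvalue A a -> Num.sg (xi j) = - Num.sg a).
Hypothesis (q_lanczos : rational_lanczos A v m xi q alpha beta).
Hypothesis (no_breakdown : forall j : nat, (1 <= j <= m)%N -> beta j != 0).
Hypothesis (K_nonsing : forall j : nat, (1 <= j <= m)%N ->
       Kmx xi alpha beta j \in unitmx).

Let q0 : q 0%N = 0. Proof. by case: q_lanczos. Qed.
Let q1 : q 1%N = v. Proof. by case: q_lanczos. Qed.

Lemma v_dotv : dotv v v = 1.
Proof. by rewrite -(sqr_sqrtr (dotvv_ge0 v)) -/(enorm v) v_unit expr1n. Qed.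

(** An eigenvalue of A, needed to exploit the sign condition, exists only in
    positive dimension. *)
Lemma dim_gt0 : (0 < n)%N.
Proof.
case: (n) v v_dotv => // v0; rewrite dotvE big_ord0 => /eqP.
by rewrite eq_sym oner_eq0.
Qed.

Lemma definite_sgr :
  exists e, forall x : 'cV[R]_n, x != 0 -> Num.sg (dotv x (A *m x)) = e.
Proof.
case: A_def => h; first by exists 1 => x /h; apply: gtr0_sg.
by exists (-1) => x /h; apply: ltr0_sg.
Qed.

(** An eigenvector of A transfers the sign of the quadratic form to an
    eigenvalue, and from there to all the shifts. *)
Lemma shift_sgr : exists e,
  (forall x : 'cV[R]_n, x != 0 -> Num.sg (dotv x (A *m x)) = e) /\
  forall j, (0 < j <= m)%N -> Num.sg (sV j) = - e.
Proof.
have [e he] := definite_sgr; exists e; split=> // -[|j] // jm.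
have [a aA] := symmetric_eigenvalue dim_gt0 A_sym.
rewrite /= sgrV (xi_sign jm aA).
have /eigenvalueP [x xA x0] := aA.
have x0' : x^T != 0 by rewrite -trmx0 (inj_eq (@trmx_inj _ _ _)).
have := he _ x0'; rewrite dotvM A_sym -{1}A_sym -trmx_mul xA.
have := dotvv_gt0 x0'.
rewrite linearZ /= dotvC dotvZr sgrM => /gtr0_sg ->.
by rewrite mulr1 => ->.
Qed.

Lemma shift_le0 j : (j <= m)%N -> forall x, sV j * dotv x (A *m x) <= 0.
Proof.
move=> jm x; have [e [he hs]] := shift_sgr.
have [->|x0] := eqVneq x 0; first by rewrite mulmx0 dotv0 mulr0.
case: j jm => [|j] jm; first by rewrite mul0r.
by rewrite -sgr_le0 sgrM hs // he // mulNr oppr_le0 -expr2 sqr_ge0.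
Qed.

Lemma shift_mul_ge0 i j : (i <= m)%N -> (j <= m)%N -> 0 <= sV i * sV j.
Proof.
have [e [he hs]] := shift_sgr.
case: i => [|i] im; first by rewrite mul0r.
case: j => [|j] jm; first by rewrite mulr0.
by rewrite -sgr_ge0 sgrM !hs // mulrNN -expr2 sqr_ge0.
Qed.

(** The recurrence multiplied by I - A / xi_j, which is invertible. *)
Lemma lanczos_rec j : (0 < j <= m)%N ->
  pencil A (sV j) *m (beta j *: q j.+1) =
    A *m q j - alpha j *: (pencil A (sV (j - 1)) *m q j)
    - beta (j - 1)%N *: (pencil A (sV (j - 2)) *m q (j - 1)%N).
Proof.
move=> jm; have [_ _ _ /(_ j jm)] := q_lanczos => /= -[_ _ ->].
rewrite scalerA divff ?no_breakdown // scale1r mulmxBr -scalemxAr.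
have jm' : (j <= m)%N by case/andP: jm.
have Bu : shiftmx A xi j \in unitmx by exact: pencil_unit (shift_le0 jm').
by rewrite -[pencil A (sV j)]/(shiftmx A xi j) !mulKVmx // addrAC.
Qed.

(** The recurrence with all multiples of A moved to one side: the coefficients
    are those of the j-th columns of K and of H. *)
Lemma lanczos_combination j : (0 < j <= m)%N ->
  A *m ((beta (j - 1)%N * sV (j - 1 - 1)) *: q (j - 1)%N
        + (1 + alpha j * sV (j - 1)) *: q j + (beta j * sV j) *: q j.+1) =
  beta (j - 1)%N *: q (j - 1)%N + alpha j *: q j + beta j *: q j.+1.
Proof.
move=> jm; have := lanczos_rec jm; rewrite !pencil_mul -subnDA.
rewrite !mulmxDr -!scalemxAr.
move: (A *m q j) (A *m q j.+1) (A *m q (j - 1)%N) => a b c.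
rewrite !scalerBr !scalerA => E; apply/eqP; rewrite -subr_eq0; apply/eqP.
move/eqP: E; rewrite -subr_eq0 => /eqP E; rewrite -[RHS]oppr0 -E.
by apply/colP => i; rewrite !mxE; ring.
Qed.

Lemma lanczos_matrix k : (k <= m)%N ->
  A *m (Qmx q k *m Kmx xi alpha beta k
        + (beta k * sV k) *: (q k.+1 *m (evec k k)^T)) =
  Qmx q k *m Hmx alpha beta k + beta k *: (q k.+1 *m (evec k k)^T).
Proof.
move=> km; rewrite Kmx_tridiag Hmx_tridiag; apply: evec_mulmx_inj => l lk.
pose f i := beta i * sV i.
rewrite -mulmxA -[beta k * sV k]/(f k) !Qmx_tridiag_evec //.
by apply: lanczos_combination; lia.
Qed.

Lemma shift_ratio_neq0 i j x : (i <= m)%N -> (j <= m)%N -> dotv x x = 1 ->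
  dotv x (pencil A (sV i) *m (invmx (pencil A (sV j)) *m x)) != 0.
Proof.
move=> im jm xx; have x0 : x != 0 by rewrite -dotvv_eq0 xx oner_neq0.
rewrite lt0r_neq0 //; apply: pencil_ratio_gt0 => //; last exact: shift_mul_ge0.
  exact: shift_le0.
exact: shift_le0.
Qed.

(** Orthogonality to q_j is the choice of alpha_j, whose denominator is nonzero by
    the sign condition; unit length is the choice of beta_j. *)
Lemma lanczos_scalars j : (0 < j <= m)%N ->
  dotv (q j) (q j) = 1 ->
  dotv (q j) (beta j *: q j.+1) = 0 /\ dotv (q j.+1) (q j.+1) = 1.
Proof.
move=> jm qq; have [_ _ _ /(_ j jm)] := q_lanczos => /=.
set r := invmx _ *m (_ - _); set s := invmx _ *m (_ *m _) => -[aE bE ->].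
have b0 := no_breakdown jm.
rewrite scalerA divff // scale1r dotvBr dotvZr; split; last first.
  rewrite dotvZr dotvC dotvZr -(sqr_sqrtr (dotvv_ge0 _)) -/(enorm _) -bE.
  by rewrite expr2 mulKf // mulVf.
rewrite (dotvC _ r) (dotvC _ s) aE divfK ?subrr // dotvC /s.
have [jm1 jm2] : (j <= m)%N /\ (j - 1 <= m)%N by lia.
have := shift_ratio_neq0 jm2 jm1 qq.
rewrite (dotvM _ (invmx _)) trmx_inv -/(pencil A (sV j)) (tr_pencil A_sym).
by rewrite (dotvM _ (shiftmx _ _ _)) (tr_pencil A_sym) [in X in X -> _]dotvC.
Qed.

Definition lanczos_orthonormal k := forall i j,
  (0 < i <= k)%N -> (0 < j <= k)%N -> dotv (q i) (q j) = (i == j)%:R.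

Lemma Qmx_orthonormal k : lanczos_orthonormal k -> (Qmx q k)^T *m Qmx q k = 1%:M.
Proof.
move=> orth; apply/matrixP => i j; rewrite !mxE.
transitivity (dotv (q i.+1) (q j.+1)); last by rewrite orth ?ltn_ord.
by rewrite dotvE; apply: eq_bigr => l _; rewrite !mxE.
Qed.

Lemma trQmx_mul k x : (forall i, (0 < i <= k)%N -> dotv (q i) x = 0) <-> (Qmx q k)^T *m x = 0.
Proof.
have QxE (i : 'I_k) : ((Qmx q k)^T *m x) i 0 = dotv (q i.+1) x.
  by rewrite dotvE !mxE; apply: eq_bigr => l _; rewrite !mxE.
split=> [qx|Qx [|i] // ik]; first by apply/colP => i; rewrite QxE qx ?mxE ?ltn_ord.
by rewrite -(QxE (Ordinal ik)) Qx mxE.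
Qed.

Lemma lanczos_orthonormalP k : (k <= m)%N -> lanczos_orthonormal k.+1.
Proof.
elim: k => [|k IH] km.
  move=> i j i1 j1; have [-> ->] : i = 1%N /\ j = 1%N by lia.
  by rewrite q1 v_dotv.
have {}IH := IH (ltnW km).
have orthk : lanczos_orthonormal k by move=> i j ik jk; apply: IH; lia.
have qq : dotv (q k.+1) (q k.+1) = 1 by rewrite IH ?eqxx //; lia.
have [qw q'q'] := lanczos_scalars (km : (0 < k.+1 <= m)%N) qq.
have Qq : (Qmx q k)^T *m q k.+1 = 0.
  by apply/trQmx_mul => i ik; rewrite IH ?ltn_eqF //; lia.
(* The 0 x 0 matrix K_0 is nonsingular as well. *)
have Kk : Kmx xi alpha beta k \in unitmx.
  case: k km {IH orthk qq qw q'q' Qq} => [|k] km; last by apply: K_nonsing; lia.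
  by rewrite unitmxE det_mx00 unitr1.
have Bu : pencil A (sV k.+1) \in unitmx by exact: pencil_unit (shift_le0 km).
have Qw : (Qmx q k)^T *m (beta k.+1 *: q k.+2) = 0.
  apply: (lanczos_step_orth (e := evec k k) (H := Hmx alpha beta k) (s'' := sV (k - 1))
    (a := alpha k.+1) A_sym (Qmx_orthonormal orthk) Qq qq _ _ Kk Bu _ _ qw).
  - exact: lanczos_matrix (ltnW km).
  - case: (posnP k) => [k0|k0].
      by rewrite [evec k k]evec_eq0 ?k0 // !mulmx0 scaler0 subr0.
    rewrite Kmx_tridiag Hmx_tridiag !tr_tridiag !tridiag_evec ?k0 ?leqnn //.
    rewrite [evec k k.+1]evec_eq0 ?ltnSn ?orbT // !scaler0 !addr0.
    by apply/colP => i; rewrite !mxE; ring.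
  - by apply: shift_ratio_neq0 => //; apply: ltnW.
  - have := lanczos_rec (km : (0 < k.+1 <= m)%N); rewrite !subSS !subn0 => ->.
    congr (_ - _ *: (_ *m _)); case: (posnP k) => [k0|k0].
      by rewrite evec_eq0 ?k0 // mulmx0 q0.
    by rewrite Qmx_evec ?k0 ?leqnn.
have q'0 i : (0 < i <= k.+1)%N -> dotv (q i) (q k.+2) = 0.
  move=> ik; apply: (mulfI (no_breakdown (km : (0 < k.+1 <= m)%N))).
  rewrite mulr0 -dotvZr; have [->//|ik'] := eqVneq i k.+1.
  by move/trQmx_mul: Qw; apply; lia.
move=> i j ik jk.
have [->|ik'] := eqVneq i k.+2.
  have [->//|jk'] := eqVneq j k.+2; rewrite dotvC q'0 //; lia.
have [->|jk'] := eqVneq j k.+2; first by rewrite q'0 ?(negPf ik') //; lia.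
by apply: IH; lia.
Qed.

Lemma yvec_pivot j : (0 < j <= m)%N ->
  [/\ omega xi alpha beta j != 0,
      Kmx xi alpha beta j *m yvec xi alpha beta j = evec j j &
      dotv (evec j j) (yvec xi alpha beta j) = (omega xi alpha beta j)^-1].
Proof.
rewrite Kmx_tridiag; apply: tridiag_pivot => [||i i0|i i0|i im] //.
- by rewrite mulr0 addr0.
- exact: omegaS.
- by rewrite subSS subn0 -[i.+1]addn1 -[2%N]/(1 + 1)%N subnDr.
- by rewrite -Kmx_tridiag K_nonsing.
Qed.

Lemma tvec_pivot j : (0 < j <= m)%N ->
  (Kmx xi alpha beta j)^T *m tvec xi alpha beta j = evec j j.
Proof.
rewrite Kmx_tridiag tr_tridiag => jm.
pose w := omega xi alpha beta; pose c i := beta (i - 1)%N * sV (i - 1).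
suff [] : [/\ w j != 0, tridiag (fun i => 1 + alpha i * sV (i - 1)) (fun i => beta i * sV i)
    (fun i => beta i * sV (i - 1)) j *m zvec w c j = evec j j &
    dotv (evec j j) (zvec w c j) = (w j)^-1] by [].
apply: tridiag_pivot jm => [||i i0|i i0|i im] //.
- by rewrite mulr0 addr0.
- by rewrite /w omegaS // [X in _ - X / _]mulrC.
- by rewrite /c subSS subn0.
- by rewrite -tr_tridiag -Kmx_tridiag unitmx_tr K_nonsing.
Qed.

(** Testing the matrix identity against q_{j+1} determines Q_j^T A q_{j+1} as a
    multiple of t_j; testing it against Q_j then gives J_j K_j. *)
Lemma Jmx_last_col j : (0 < j <= m)%N ->
  Jmx A q j *m evec j j = yhat xi alpha beta j
   - (beta j ^+ 2 * sV j * (1 - sV j * dotv (q j.+1) (A *m q j.+1)) / omega xi alpha beta j)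
     *: tvec xi alpha beta j.
Proof.
move=> jm; have [j0 jm'] := andP jm.
have orth := lanczos_orthonormalP jm'.
set y := yvec xi alpha beta j; set t := tvec xi alpha beta j.
set w := omega xi alpha beta j; set eta := dotv _ _.
have [w0 Ky ey] : [/\ w != 0, Kmx xi alpha beta j *m y = evec j j & dotv (evec j j) y = w^-1].
  exact: yvec_pivot.
have Kt : (Kmx xi alpha beta j)^T *m t = evec j j by exact: tvec_pivot.
have QQ : (Qmx q j)^T *m Qmx q j = 1%:M.
  by apply: Qmx_orthonormal => i l ij lj; apply: orth; lia.
have Qq : (Qmx q j)^T *m q j.+1 = 0.
  by apply/trQmx_mul => i ik; rewrite orth ?ltn_eqF //; lia.
have qQ : (q j.+1)^T *m Qmx q j = 0 by apply: trmx_inj; rewrite trmx_mul trmxK Qq trmx0.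
have qq : (q j.+1)^T *m q j.+1 = 1%:M.
  by rewrite trmx_mul_dotv orth ?eqxx //; lia.
have AQK := lanczos_matrix jm'.
set g := (Qmx q j)^T *m (A *m q j.+1).
have qAQ : (q j.+1)^T *m A *m Qmx q j = g^T by rewrite !trmx_mul trmxK A_sym.
have gE : g = (beta j * (1 - sV j * eta)) *: t.
  have Ku : (Kmx xi alpha beta j)^T \in unitmx by rewrite unitmx_tr K_nonsing.
  apply: (can_inj (mulKmx Ku)); rewrite -scalemxAr Kt.
  have E : g^T *m Kmx xi alpha beta j + (beta j * sV j) *: (eta *: (evec j j)^T) =
      beta j *: (evec j j)^T.
    have := congr1 (mulmx (q j.+1)^T) AQK.
    rewrite !mulmxDr -!scalemxAr !mulmxA qAQ qQ qq mul0mx add0r mul1mx => <-.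
    by rewrite -[_^T *m A *m _]mulmxA trmx_mul_dotv -/eta mul_scalar_mx.
  apply: trmx_inj; rewrite trmx_mul trmxK linearZ /=.
  by rewrite mulrBr mulr1 scalerBl -E mulrA -[in X in _ - X]scalerA addrK.
have JK : Jmx A q j *m Kmx xi alpha beta j + (beta j * sV j) *: (g *m (evec j j)^T) =
    Hmx alpha beta j.
  have := congr1 (mulmx (Qmx q j)^T) AQK.
  rewrite !mulmxDr -!scalemxAr !mulmxA QQ Qq mul0mx scaler0 addr0 mul1mx => <-.
  by rewrite /g !mulmxA.
rewrite /yhat -/y -JK mulmxDl -mulmxA Ky -scalemxAl -mulmxA trmx_mul_dotv ey.
rewrite mul_mx_scalar gE !scalerA.
rewrite -addrA -[LHS]addr0; congr (_ + _).
by rewrite -scalerBl -[LHS](scale0r t); congr (_ *: _); ring.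
Qed.

(** * The recursion for H_j y_j *)

Lemma yhatS i : (0 < i)%N -> let j := i.+1 in
  let w := omega xi alpha beta in let yh := yhat xi alpha beta in
  let y := yvec xi alpha beta in
  yh j = snoc (- (beta i * sV (i - 1) / w j) *: yh i)
              (beta i * dotv (evec j i) (y j) + alpha j / w j)
         + (beta i / w j) *: evec j i.
Proof.
case: i => // i _ j w yh y.
have yE : y j = snoc (- (beta i.+1 * sV (i.+1 - 1) / w j) *: y i.+1) (w j)^-1.
  rewrite /y /yvec zvecS snocZ mulr1 scalerA mulrN mulrC.
  by rewrite !subSS !subn0.
have eE : dotv (evec j i.+1) (y j) =
    dotv (evec i.+1 i.+1) (- (beta i.+1 * sV (i.+1 - 1) / w j) *: y i.+1).
  rewrite (@dotv_evecl _ _ _ _ (lift ord_max ord_max)); last by rewrite lift_max.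
  by rewrite (@dotv_evecl _ _ _ _ ord_max) // yE snoc_lift.
rewrite eE /yh /yhat -/y yE Hmx_tridiag tridiag_snoc -scalemxAr.
by rewrite [evec j i.+1]snoc_evec // snocZ snocD mulr0 addr0.
Qed.

End Lanczos.

Theorem theorem2p2 (R : rcfType) (n m : nat) (A : 'M[R]_n) (v : 'cV[R]_n)
    (xi : nat -> R) (q : nat -> 'cV[R]_n) (alpha beta : nat -> R)
    (A_sym : A^T = A)
    (A_def : definite A)
    (v_unit : enorm v = 1)
    (xi_neq0 : forall j : nat, (1 <= j <= m)%N -> xi j != 0)
    (xi_sign : forall (j : nat) (a : R), (1 <= j <= m)%N ->
       eigenvalue A a -> Num.sg (xi j) = - Num.sg a)
    (q_lanczos : rational_lanczos A v m xi q alpha beta)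
    (no_breakdown : forall j : nat, (1 <= j <= m)%N -> beta j != 0)
    (K_nonsing : forall j : nat, (1 <= j <= m)%N ->
       Kmx xi alpha beta j \in unitmx) :
  let J := Jmx A q in
  let w := omega xi alpha beta in
  let y := yvec xi alpha beta in
  let t := tvec xi alpha beta in
  let yh := yhat xi alpha beta in
  [/\ forall j : nat, (1 <= j <= m)%N ->
        let eta := dotv (q j.+1) (A *m q j.+1) in
        let rhs := yh j
          - (beta j ^+ 2 / xi j ^+ 2 * ((xi j - eta) / w j)) *: t j in
        J j *m evec j j = rhs /\ ((evec j j)^T *m J j)^T = rhs,
      yh 1%N = const_mx (alpha 1%N) &
      forall i : nat, (1 <= i < m)%N ->
        let j := i.+1 in
        yh j =
          snoc (- (beta i * shiftV xi (i - 1) / w j) *: yh i)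
               (beta i * dotv (evec j i) (y j) + alpha j / w j)
          + (beta i / w j) *: evec j i].
Proof.
move=> J w y t yh; split=> [j jm eta rhs||i /andP[i0 _]]; last exact: yhatS.
- have rhsE : J j *m evec j j = rhs.
    rewrite (Jmx_last_col A_sym A_def v_unit xi_sign q_lanczos) // /rhs.
    congr (_ - _ *: _); have := xi_neq0 j jm; rewrite -/eta -/w.
    have -> : shiftV xi j = (xi j)^-1 by case: (j) jm.
    by move=> x0; rewrite mulrA; congr (_ / _); field.
  by split=> //; rewrite trmx_mul trmxK /J /Jmx !trmx_mul trmxK A_sym mulmxA.
- apply/colP => i; rewrite !mxE big_ord1 !mxE /= mulr1.
  by rewrite ord1 eqxx.
Qed.
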